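(* Consider the Lagrangian system $\dot p=v$, $\dot v=f(p,v)+g(p,v)u$, and let $h(p)=1-(p-p_0)^TA(p-p_0)$, $h'(p,v)=\frac{\partial h(p)}{\partial p}v+\alpha(h(p))$, $\mathcal{C}=\{p\in\mathcal{X}_{\mathrm{free}}:h(p)\ge0\}$ and $\mathcal{C}'=\{(p,v)\in\mathbb{R}^n\times\mathbb{R}^n:h'(p,v)\ge0\}$. Then $h'(p,v)$ is a feasible control barrier function for almost all $(p,v)$ for this system, i.e. there exist $u(p,v)$ and extended class $\mathcal{K}_\infty$ functions $\alpha,\alpha'$ such that $$v^T\frac{\partial^2h(p)}{\partial p^2}v+\frac{\partial\alpha(h(p))}{\partial p}v+\frac{\partial h(p)}{\partial p}f(p,v)+\frac{\partial h(p)}{\partial p}g(p,v)u+\alpha'(h'(p,v))\ge0$$ holds for all $p\in\mathcal{D}\supseteq\mathcal{C}$ and $(p,v)\in\mathcal{D}'\supseteq\mathcal{C}'$, except for $p=p_0$, where it is infeasible if $v$ is unbounded. In the case of $v$ being bounded (i.e. $v$ ranging over a bounded set), $h'(p,v)$ is also feasible at $p=p_0$, i.e. there exist such $\alpha,\alpha'$ and $u(p,v)$ for which the inequality also holds at $p=p_0$.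
   Context: System: $p,v,u\in\mathbb{R}^n$; $f:\mathbb{R}^n\times\mathbb{R}^n\to\mathbb{R}^n$ and $g:\mathbb{R}^n\times\mathbb{R}^n\to\mathbb{R}^{n\times n}$ are locally Lipschitz continuous and $g(p,v)$ has full row rank for every $(p,v)$. The workspace $\mathcal{X}\subset\mathbb{R}^n$ is bounded and divided into obstacles $\mathcal{X}_{\mathrm{obs}}$ and free space $\mathcal{X}_{\mathrm{free}}=\mathcal{X}\setminus\mathcal{X}_{\mathrm{obs}}$. $A\in\mathbb{R}^{n\times n}$ is symmetric positive definite and $p_0\in\mathcal{X}_{\mathrm{free}}$ is the center of an obstacle-free ellipsoid (contained in $\mathcal{X}_{\mathrm{free}}$). A class $\mathcal{K}$ function is a strictly increasing function vanishing at $0$; an extended class $\mathcal{K}_\infty$ function is such a function defined over an interval $(-b,c)$, $b,c>0$ (here large enough that the compositions are defined). The derivative of $\alpha(h(p))$ appears in the inequality, so $\alpha$ is understood to be differentiable. $\mathcal{D}\supseteq\mathcal{C}$ and $\mathcal{D}'\supseteq\mathcal{C}'$ are some open sets. The displayed inequality is the control barrier function condition $\frac{\partial h'}{\partial p}v+\frac{\partial h'}{\partial v}(f(p,v)+g(p,v)u)\ge-\alpha'(h'(p,v))$ for $h'$. ''Feasible at $(p,v)$'' means that there is a $u\in\mathbb{R}^n$ satisfying this inequality at $(p,v)$; ''infeasible at $p=p_0$ if $v$ is unbounded'' means that at $p=p_0$ the inequality cannot be satisfied for all $v$ when $v$ ranges over an unbounded set. *)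

(* Defs.v *)
From mathcomp Require Import all_boot all_order all_algebra.
From mathcomp Require Import all_classical all_reals all_analysis.

Set Implicit Arguments.
Unset Strict Implicit.
Unset Printing Implicit Defensive.

Import Order.TTheory GRing.Theory Num.Theory.
Import numFieldNormedType.Exports.

Local Open Scope classical_set_scope.
Local Open Scope ring_scope.

Definition locally_lipschitz (R : realType) (U W : normedModType R)
    (f : U -> W) : Prop :=
  forall x : U, exists2 N : set U, nbhs x N & [lipschitz f y | y in N].

Definition sym_posdef (R : realType) (n : nat) (A : 'M[R]_n) : Prop :=
  A^T = A /\ forall x : 'cV[R]_n, x != 0 -> 0 < (x^T *m A *m x) 0 0.

Definition grad (R : realType) (n : nat) (F : 'cV[R]_n -> R) (p : 'cV[R]_n) :
    'rV[R]_n :=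
  \row_i 'D_(delta_mx i 0) F p.

Definition hess (R : realType) (n : nat) (F : 'cV[R]_n -> R) (p : 'cV[R]_n) :
    'M[R]_n :=
  \matrix_(i, j) 'D_(delta_mx i 0) (fun q => 'D_(delta_mx j 0) F q) p.

(* The interval (-b, c); the ends are extended reals because alpha and alpha'
   have to be applied to unbounded functions of (p, v). *)
Definition Kdom (R : realType) (b c : \bar R) : set R :=
  [set x | (- b < x%:E)%E /\ (x%:E < c)%E].

(* An extended class K-infinity function on (-b, c) is represented by a total
   function whose values outside Kdom b c are irrelevant. *)
Definition ext_class_Kinfty (R : realType) (b c : \bar R) (a : R -> R) : Prop :=
  [/\ (0 < b)%E, (0 < c)%E, a 0 = 0 &
      forall x y, Kdom b c x -> Kdom b c y -> x < y -> a x < a y].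

Definition differentiable_on_Kdom (R : realType) (b c : \bar R) (a : R -> R) :
    Prop :=
  forall x, Kdom b c x -> derivable a x 1.

Definition ellipsoid_fun (R : realType) (n : nat) (A : 'M[R]_n)
    (p0 p : 'cV[R]_n) : R :=
  1 - ((p - p0)^T *m A *m (p - p0)) 0 0.

Definition lifted (R : realType) (n : nat) (h : 'cV[R]_n -> R) (alpha : R -> R)
    (p v : 'cV[R]_n) : R :=
  (grad h p *m v) 0 0 + alpha (h p).

Definition safe_set (R : realType) (n : nat) (Xfree : set 'cV[R]_n)
    (h : 'cV[R]_n -> R) : set 'cV[R]_n :=
  [set p | Xfree p /\ 0 <= h p].

Definition lifted_safe_set (R : realType) (n : nat) (h : 'cV[R]_n -> R)
    (alpha : R -> R) : set ('cV[R]_n * 'cV[R]_n) :=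
  [set z | 0 <= lifted h alpha z.1 z.2].

Definition cbf_ineq (R : realType) (n : nat)
    (f : 'cV[R]_n * 'cV[R]_n -> 'cV[R]_n)
    (g : 'cV[R]_n * 'cV[R]_n -> 'M[R]_n)
    (h : 'cV[R]_n -> R) (alpha alpha' : R -> R) (p v u : 'cV[R]_n) : Prop :=
  0 <= (v^T *m hess h p *m v) 0 0
       + (grad (fun q => alpha (h q)) p *m v) 0 0
       + (grad h p *m f (p, v)) 0 0
       + (grad h p *m g (p, v) *m u) 0 0
       + alpha' (lifted h alpha p v).

Definition cbf_data (R : realType) (n : nat) (Xfree : set 'cV[R]_n)
    (h : 'cV[R]_n -> R) (b c b' c' : \bar R) (alpha alpha' : R -> R)
    (D : set 'cV[R]_n) (D' : set ('cV[R]_n * 'cV[R]_n)) : Prop :=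
  [/\ [/\ ext_class_Kinfty b c alpha, differentiable_on_Kdom b c alpha &
          ext_class_Kinfty b' c' alpha'],
      open D /\ safe_set Xfree h `<=` D,
      open D' /\ lifted_safe_set h alpha `<=` D',
      forall p, D p -> Kdom b c (h p) &
      forall p v, D' (p, v) ->
        Kdom b c (h p) /\ Kdom b' c' (lifted h alpha p v)].

(* Main.v *)
Require Import Defs.
From mathcomp Require Import all_boot all_order all_algebra.
From mathcomp Require Import all_classical all_reals all_analysis.
From mathcomp Require Import ring lra.

Set Implicit Arguments.
Unset Strict Implicit.
Unset Printing Implicit Defensive.

Import Order.TTheory GRing.Theory Num.Theory.
Import numFieldNormedType.Exports.

Local Open Scope classical_set_scope.
Local Open Scope ring_scope.

(** With [q = p - p0], [grad h p = -2 q^T A] and [hess h p = -2 A].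
    Off the center, [g] is invertible and [q^T A q > 0], so the choice
    [u = t g^-1 q] gives the control term any prescribed value.
    At the center both gradient terms vanish and the condition reads
    [2 v^T A v <= alpha' (alpha 1)]. By Cauchy-Schwarz against [A^-1 e_i] the
    sublevel sets of [v^T A v] are bounded, which excludes unbounded [v]; for
    bounded [v] it suffices to take [alpha = id] and [alpha'] linear with a
    large slope. *)

(** * Directional derivatives by restriction to lines *)

Lemma derive_along_line (R : realType) (V : normedModType R) (F : V -> R)
    (p e : V) :
  'D_e F p = 'D_1 (fun t : R => F (p + t *: e)) (0 : R).
Proof.
rewrite /derive; set a := (X in lim (X @ _) = _).
set b := (X in _ = lim (X @ _)).
(* The two difference quotients agree pointwise, so their limits agree whether or not they
   converge. *)
suff -> : a = b by [].
apply/funext => t; rewrite /a /b /=.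
by rewrite scale0r !addr0 [t *: 1]mulr1 [p + _]addrC.
Qed.

(** A polynomial in [t] has its linear coefficient as derivative at [0]. Gradient and Hessian of
    [ellipsoid_fun] are both read off in this way, without a matrix chain rule. *)
Lemma derive_quadratic (R : realType) (V : normedModType R) (F : V -> R)
    (p e : V) (a b : R) :
  (forall t, F (p + t *: e) = F p + a * t + b * t ^+ 2) -> 'D_e F p = a.
Proof.
move=> FE; rewrite derive_along_line (eq_fun FE).
suff Q : is_derive (0 : R) 1 (fun t : R => F p + a * t + b * t ^+ 2) a.
  exact: derive_val.
apply: is_derive_eq.
by rewrite add0r mul1r !scale0r addr0 scaler0 addr0 [LHS]mulr1.
Qed.

(** * The bilinear form of a matrix *)

Definition qform (R : comNzRingType) (n : nat) (A : 'M[R]_n)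
    (x y : 'cV[R]_n) : R :=
  (x^T *m A *m y) 0 0.

Lemma qformDl (R : comNzRingType) (n : nat) (A : 'M[R]_n) (x y z : 'cV[R]_n) :
  qform A (x + y) z = qform A x z + qform A y z.
Proof. by rewrite /qform linearD /= !mulmxDl mxE. Qed.

Lemma qformDr (R : comNzRingType) (n : nat) (A : 'M[R]_n) (x y z : 'cV[R]_n) :
  qform A x (y + z) = qform A x y + qform A x z.
Proof. by rewrite /qform mulmxDr mxE. Qed.

Lemma qformZl (R : comNzRingType) (n : nat) (A : 'M[R]_n) (k : R)
    (x y : 'cV[R]_n) :
  qform A (k *: x) y = k * qform A x y.
Proof. by rewrite /qform linearZ /= -!scalemxAl mxE. Qed.

Lemma qformZr (R : comNzRingType) (n : nat) (A : 'M[R]_n) (k : R)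
    (x y : 'cV[R]_n) :
  qform A x (k *: y) = k * qform A x y.
Proof. by rewrite /qform -scalemxAr mxE. Qed.

Lemma qform0l (R : comNzRingType) (n : nat) (A : 'M[R]_n) (y : 'cV[R]_n) :
  qform A 0 y = 0.
Proof. by rewrite /qform trmx0 !mul0mx mxE. Qed.

Lemma qform_delta (R : comNzRingType) (n : nat) (A : 'M[R]_n) (x : 'cV[R]_n)
    (j : 'I_n) :
  qform A x (delta_mx j 0) = (x^T *m A) 0 j.
Proof. by rewrite /qform -colE mxE. Qed.

Lemma qform_delta2 (R : comNzRingType) (n : nat) (A : 'M[R]_n) (i j : 'I_n) :
  qform A (delta_mx i 0) (delta_mx j 0) = A i j.
Proof. by rewrite qform_delta trmx_delta -rowE mxE. Qed.

Lemma qformC (R : comNzRingType) (n : nat) (A : 'M[R]_n) (x y : 'cV[R]_n) :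
  A^T = A -> qform A x y = qform A y x.
Proof.
move=> AT; rewrite /qform -[RHS](mxE trmx_key (fun i j => (y^T *m A *m x) j i)).
by rewrite -/(trmx _) !trmx_mul trmxK AT mulmxA.
Qed.

(** * Positive definite forms *)

Lemma qform_ge0 (R : realType) (n : nat) (A : 'M[R]_n) (x : 'cV[R]_n) :
  sym_posdef A -> 0 <= qform A x x.
Proof.
move=> A_spd.
have [->|x0] := eqVneq x 0; first by rewrite qform0l.
by apply/ltW; case: A_spd => _; apply.
Qed.

(** A row [r] of the left kernel satisfies [r A r^T = 0], so definiteness forces [r = 0]. *)
Lemma posdef_unitmx (R : realType) (n : nat) (A : 'M[R]_n) :
  sym_posdef A -> A \in unitmx.
Proof.
move=> A_spd.
rewrite -row_free_unit -kermx_eq0; apply/eqP/row_matrixP => i.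
rewrite row0; apply/eqP; apply/negPn/negP => ri0.
have := A_spd.2 (row i (kermx A))^T; rewrite trmxK.
have /eqP -> : row i (kermx A) *m A == 0 by rewrite -row_mul mulmx_ker row0.
by rewrite mul0mx mxE ltxx trmx_eq0 => /(_ ri0).
Qed.

Lemma qform_cauchy_schwarz (R : realType) (n : nat) (A : 'M[R]_n)
    (x y : 'cV[R]_n) :
  sym_posdef A -> qform A x y ^+ 2 <= qform A x x * qform A y y.
Proof.
move=> A_spd.
have [->|y0] := eqVneq y 0; first by rewrite /qform !mulmx0 mxE expr0n mulr0.
have yy : 0 < qform A y y by case: A_spd => _; apply.
(* With [s], [r], [q] as named below, this form expands to [s * (q * s - r ^+ 2)]; the factor
   [s > 0] is then cancelled. *)
have := qform_ge0 (qform A y y *: x + (- qform A x y) *: y) A_spd.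
rewrite !(qformDl, qformDr, qformZl, qformZr) (qformC y x A_spd.1).
set s := qform A y y in yy *; set r := qform A x y; set q := qform A x x => H.
by rewrite -subr_ge0 -(pmulr_rge0 _ yy); nra.
Qed.

(** For [y = A^-1 e_i], the form pairs [x] with [y] to give the entry [x i 0], and [y] with itself
    to give the diagonal entry [invmx A i i]. *)
Lemma sqr_entry_le_qform (R : realType) (n : nat) (A : 'M[R]_n)
    (x : 'cV[R]_n) (i : 'I_n) :
  sym_posdef A -> x i 0 ^+ 2 <= qform A x x * invmx A i i.
Proof.
move=> A_spd.
have E : forall y, qform A y (invmx A *m delta_mx i 0) = y i 0.
  move=> y; rewrite /qform -mulmxA mulKVmx ?(posdef_unitmx A_spd)//.
  by rewrite -colE !mxE.
have := qform_cauchy_schwarz x (invmx A *m delta_mx i 0) A_spd.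
by rewrite !E -colE mxE.
Qed.

(** * Bounded sets and sublevel sets of the form *)

Lemma bounded_setP (R : realType) (V : normedModType R) (S : set V) :
  bounded_set S <-> exists M, forall x, S x -> `|x| <= M.
Proof.
split=> [[M [_ H]]|[M H]].
  by exists (M + 1) => x Sx; apply: H Sx; rewrite ltrDl.
exists M; split=> [|N MN x Sx]; first exact: num_real.
exact: le_trans (H x Sx) (ltW MN).
Qed.

Lemma mx_norm_leP (R : realType) (m n : nat) (x : 'M[R]_(m, n)) (M : R) :
  0 <= M -> (forall i j, `|x i j| <= M) -> `|x| <= M.
Proof.
move=> M0 xM; rewrite /Num.norm /= mx_normrE.
by apply: bigmax_le => // -[i j] _; exact: xM.
Qed.

Lemma mx_entry_le_norm (R : realType) (m n : nat) (x : 'M[R]_(m, n)) i j :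
  `|x i j| <= `|x|.
Proof.
rewrite [leRHS]/Num.norm /= mx_normrE.
exact: (le_bigmax _ (fun ij => `|x ij.1 ij.2|) (i, j)).
Qed.

Lemma qform_bounded_above (R : realType) (n : nat) (A : 'M[R]_n)
    (V : set 'cV[R]_n) :
  bounded_set V -> exists M, forall v, V v -> qform A v v <= M.
Proof.
move=> /bounded_setP[B VB].
exists (\sum_j \sum_i B * `|A i j| * B) => v Vv.
rewrite /qform mxE ler_sum// => j _; rewrite mxE mulr_suml ler_sum// => i _.
rewrite !mxE (le_trans (ler_norm _))// !normrM.
have vB k : `|v k 0| <= B by exact: le_trans (mx_entry_le_norm _ _ _) (VB v Vv).
by rewrite ler_pM ?mulr_ge0// ler_wpM2r.
Qed.

Lemma qform_sublevel_bounded (R : realType) (n : nat) (A : 'M[R]_n) (M : R) :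
  sym_posdef A -> bounded_set [set v | qform A v v <= M].
Proof.
move=> A_spd; apply/bounded_setP.
(* The sum makes the entrywise bound uniform in [i]. Square roots are avoided: for [t >= 0],
   [t ^+ 2 <= k] implies [t <= 1 + k]. *)
exists (1 + `|M| * \sum_i `|invmx A i i|) => v /= vM.
have S0 : 0 <= \sum_i `|invmx A i i| by rewrite sumr_ge0.
apply: mx_norm_leP => [|i j]; first by rewrite addr_ge0// mulr_ge0.
rewrite ord1; have iS : `|invmx A i i| <= \sum_i `|invmx A i i|.
  by rewrite (bigD1 i)//= lerDl sumr_ge0.
have : v i 0 ^+ 2 <= `|M| * \sum_i `|invmx A i i|.
  apply: le_trans (sqr_entry_le_qform v i A_spd) _.
  rewrite (le_trans (ler_norm _))// normrM ler_pM//.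
  by rewrite ger0_norm ?qform_ge0// (le_trans vM)// ler_norm.
rewrite -[v i 0 ^+ 2]real_normK ?num_real//.
have := normr_ge0 (v i 0).
by move: (`|v i 0|) (_ * _) => t k; nra.
Qed.

(** * Derivatives of the ellipsoid function *)

Lemma ellipsoid_funE (R : realType) (n : nat) (A : 'M[R]_n) (p0 p : 'cV[R]_n) :
  ellipsoid_fun A p0 p = 1 - qform A (p - p0) (p - p0).
Proof. by []. Qed.

(** This is the exact second-order Taylor expansion; symmetry of [A] merges the two cross terms. *)
Lemma ellipsoid_fun_line (R : realType) (n : nat) (A : 'M[R]_n)
    (p0 p e : 'cV[R]_n) (t : R) : A^T = A ->
  ellipsoid_fun A p0 (p + t *: e) =
  ellipsoid_fun A p0 p + (- 2 * qform A (p - p0) e) * t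
    + (- qform A e e) * t ^+ 2.
Proof.
move=> AT; rewrite !ellipsoid_funE [p + _ - p0]addrAC; move: (p - p0) => q.
rewrite !(qformDl, qformDr, qformZl, qformZr) (qformC e q AT).
ring.
Qed.

Lemma derive_ellipsoid_fun (R : realType) (n : nat) (A : 'M[R]_n)
    (p0 p e : 'cV[R]_n) : A^T = A ->
  'D_e (ellipsoid_fun A p0) p = - 2 * qform A (p - p0) e.
Proof.
by move=> AT; apply: derive_quadratic => t; exact: ellipsoid_fun_line.
Qed.

Lemma grad_ellipsoid_fun (R : realType) (n : nat) (A : 'M[R]_n)
    (p0 p : 'cV[R]_n) : A^T = A ->
  grad (ellipsoid_fun A p0) p = - 2 *: ((p - p0)^T *m A).
Proof.
move=> AT; apply/rowP => i.
by rewrite !mxE derive_ellipsoid_fun// qform_delta mxE.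
Qed.

Lemma hess_ellipsoid_fun (R : realType) (n : nat) (A : 'M[R]_n)
    (p0 p : 'cV[R]_n) : A^T = A ->
  hess (ellipsoid_fun A p0) p = - 2 *: A.
Proof.
move=> AT; apply/matrixP => i j; rewrite !mxE.
under eq_fun do rewrite derive_ellipsoid_fun//.
(* The first partial derivatives are affine in [p], hence the zero quadratic coefficient. *)
apply: (derive_quadratic (b := 0)) => t.
rewrite [p + _ - p0]addrAC; move: (p - p0) => q.
by rewrite qformDl qformZl qform_delta2; ring.
Qed.

(** Along every line through the center the ellipsoid function has no linear term, so the chain rule
    multiplies the derivative of [alpha] by [0]. *)
Lemma grad_comp_ellipsoid_fun_center (R : realType) (n : nat) (A : 'M[R]_n)
    (p0 : 'cV[R]_n) (alpha : R -> R) : A^T = A ->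
  derivable alpha (ellipsoid_fun A p0 p0) 1 ->
  grad (fun q => alpha (ellipsoid_fun A p0 q)) p0 = 0.
Proof.
move=> AT dalpha; apply/rowP => i; rewrite !mxE derive_along_line.
set e := delta_mx i 0.
pose phi (t : R) := ellipsoid_fun A p0 (p0 + t *: e).
have dphi : is_derive (0 : R) 1 phi 0.
  have -> : phi = (fun t => 1 + (- qform A e e) * t ^+ 2).
    apply/funext => t; rewrite /phi ellipsoid_fun_line// ellipsoid_funE subrr.
    by rewrite !qform0l; ring.
  apply: is_derive_eq.
  by rewrite !scale0r addr0 scaler0 mulr0.
have /derivableP dalpha0 : derivable alpha (phi 0) 1.
  by rewrite /phi scale0r addr0.
have [_] := is_derive1_comp (g := phi) dalpha0 dphi.
by rewrite mulr0.
Qed.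

(** * The barrier condition at the center and away from it *)

(** The control enters only through the gradient of [h], which is zero at [p0]. Existence of a
    control thus becomes a condition on [v] alone. *)
Lemma cbf_ineq_center (R : realType) (n : nat)
    (f : 'cV[R]_n * 'cV[R]_n -> 'cV[R]_n)
    (g : 'cV[R]_n * 'cV[R]_n -> 'M[R]_n) (A : 'M[R]_n) (p0 : 'cV[R]_n)
    (alpha alpha' : R -> R) (v u : 'cV[R]_n) : A^T = A ->
  derivable alpha 1 1 ->
  cbf_ineq f g (ellipsoid_fun A p0) alpha alpha' p0 v u <->
  2 * qform A v v <= alpha' (alpha 1).
Proof.
move=> AT dalpha.
have h1 : ellipsoid_fun A p0 p0 = 1.
  by rewrite ellipsoid_funE subrr qform0l subr0.
have g0 : grad (ellipsoid_fun A p0) p0 = 0.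
  by rewrite grad_ellipsoid_fun// subrr trmx0 mul0mx scaler0.
rewrite /cbf_ineq /lifted grad_comp_ellipsoid_fun_center// ?h1// g0.
have z0 : (0 : 'M[R]_1) 0 0 = 0 by rewrite mxE.
rewrite !mul0mx z0 !addr0 add0r hess_ellipsoid_fun//.
rewrite -scalemxAr -scalemxAl mxE -/(qform A v v).
by rewrite mulNr addrC subr_ge0.
Qed.

Lemma control_term_onto (R : realType) (n : nat) (A G : 'M[R]_n)
    (p0 p : 'cV[R]_n) (a : R) :
  sym_posdef A -> row_free G -> p <> p0 ->
  exists u : 'cV[R]_n, (grad (ellipsoid_fun A p0) p *m G *m u) 0 0 = a.
Proof.
move=> A_spd Gfree pp0; rewrite grad_ellipsoid_fun ?A_spd.1//.
have : qform A (p - p0) (p - p0) != 0.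
  by apply/lt0r_neq0; case: A_spd => _; apply; rewrite subr_eq0; apply/eqP.
move: (p - p0) => q q0.
(* The denominator is the value of the control term at [invmx G *m q], nonzero off the center. *)
exists ((a / (- 2 * qform A q q)) *: (invmx G *m q)).
rewrite -scalemxAr mulmxA mulmxK -?row_free_unit// -scalemxAl.
by rewrite mxE [X in _ * X]mxE -/(qform A q q); field.
Qed.

Lemma cbf_ineq_feasible (R : realType) (n : nat)
    (f : 'cV[R]_n * 'cV[R]_n -> 'cV[R]_n)
    (g : 'cV[R]_n * 'cV[R]_n -> 'M[R]_n) (A : 'M[R]_n) (p0 : 'cV[R]_n)
    (alpha alpha' : R -> R) (p v : 'cV[R]_n) :
  sym_posdef A -> row_free (g (p, v)) -> p <> p0 ->
  exists u, cbf_ineq f g (ellipsoid_fun A p0) alpha alpha' p v u.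
Proof.
move=> A_spd gfree pp0.
have shift (a x b : R) : 0 <= a + x + b <-> - (a + b) <= x by split; lra.
have [c ineqE] : exists c : R, forall u,
    cbf_ineq f g (ellipsoid_fun A p0) alpha alpha' p v u <->
    c <= (grad (ellipsoid_fun A p0) p *m g (p, v) *m u) 0 0.
  (* Unification with [shift] collects all terms free of [u] into the threshold [c]. *)
  by eexists => u; exact: shift.
have [u uE] := control_term_onto c A_spd gfree pp0.
by exists u; apply/ineqE; rewrite uE.
Qed.

(** * Comparison functions and the final assembly *)

Lemma Kdom_infty (R : realType) (x : R) : Kdom +oo%E +oo%E x.
Proof. by rewrite /Kdom /= ltNyr ltry. Qed.

Lemma ext_class_Kinfty_scale (R : realType) (k : R) :
  0 < k -> ext_class_Kinfty +oo%E +oo%E (fun x => k * x).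
Proof. by move=> k0; split; rewrite ?mulr0// => x y _ _; rewrite ltr_pM2l. Qed.

(** Infinite interval ends and full-space [D], [D'] make every domain and inclusion condition
    automatic. *)
Lemma cbf_data_id_scale (R : realType) (n : nat) (Xfree : set 'cV[R]_n)
    (h : 'cV[R]_n -> R) (k : R) : 0 < k ->
  cbf_data Xfree h +oo%E +oo%E +oo%E +oo%E id (fun x => k * x) setT setT.
Proof.
move=> k0; split=> //; first split.
- by split=> // x y.
- by move=> x _; exact: derivable_id.
- exact: ext_class_Kinfty_scale.
- by split; [exact: openT|].
- by split; [exact: openT|].
- by move=> p _; exact: Kdom_infty.
- by move=> p v _; split; exact: Kdom_infty.
Qed.

Theorem lemma1 (R : realType) (n : nat)
    (f : 'cV[R]_n * 'cV[R]_n -> 'cV[R]_n)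
    (g : 'cV[R]_n * 'cV[R]_n -> 'M[R]_n)
    (X Xobs Xfree : set 'cV[R]_n) (A : 'M[R]_n) (p0 : 'cV[R]_n)
    (h : 'cV[R]_n -> R)
    (f_lip : locally_lipschitz f) (g_lip : locally_lipschitz g)
    (g_full : forall p v, row_free (g (p, v)))
    (X_bounded : bounded_set X) (Xobs_sub : Xobs `<=` X)
    (Xfree_def : Xfree = X `\` Xobs)
    (A_spd : sym_posdef A) (p0_free : Xfree p0)
    (h_def : h = ellipsoid_fun A p0)
    (ellipsoid_free : [set p | 0 <= h p] `<=` Xfree) :
  [/\ exists (b c b' c' : \bar R) (alpha alpha' : R -> R)
        (D : set 'cV[R]_n) (D' : set ('cV[R]_n * 'cV[R]_n))
        (u : 'cV[R]_n -> 'cV[R]_n -> 'cV[R]_n),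
        cbf_data Xfree h b c b' c' alpha alpha' D D' /\
        (forall p v, D p -> D' (p, v) -> p <> p0 ->
           cbf_ineq f g h alpha alpha' p v (u p v)),
      forall (b c b' c' : \bar R) (alpha alpha' : R -> R) (V : set 'cV[R]_n),
        ext_class_Kinfty b c alpha -> differentiable_on_Kdom b c alpha ->
        ext_class_Kinfty b' c' alpha' ->
        Kdom b c (h p0) ->
        (forall v, V v -> Kdom b' c' (lifted h alpha p0 v)) ->
        ~ bounded_set V ->
        ~ (forall v, V v -> exists u, cbf_ineq f g h alpha alpha' p0 v u)
    & forall V : set 'cV[R]_n, bounded_set V ->
      exists (b c b' c' : \bar R) (alpha alpha' : R -> R)
        (D : set 'cV[R]_n) (D' : set ('cV[R]_n * 'cV[R]_n))
        (u : 'cV[R]_n -> 'cV[R]_n -> 'cV[R]_n),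
        [/\ cbf_data Xfree h b c b' c' alpha alpha' D D',
            forall p v, D p -> D' (p, v) -> p <> p0 ->
              cbf_ineq f g h alpha alpha' p v (u p v)
          & forall v, V v -> cbf_ineq f g h alpha alpha' p0 v (u p0 v)]].
Proof.
have AT := A_spd.1.
have feas alpha alpha' : exists u : 'cV[R]_n -> 'cV[R]_n -> 'cV[R]_n,
    forall p v, p <> p0 -> cbf_ineq f g h alpha alpha' p v (u p v).
  (* Choice over pairs turns pointwise feasibility into a feedback law. The premise [z.1 <> p0] sits
     inside the existential, so any default control, here [0], serves at the center. *)
  suff /choice[u uP] : forall z : 'cV[R]_n * 'cV[R]_n, exists u, z.1 <> p0 ->
      cbf_ineq f g h alpha alpha' z.1 z.2 u.
    by exists (fun p v => u (p, v)) => p v; exact: (uP (p, v)).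
  move=> [p v] /=; have [->|/eqP pp0] := eqVneq p p0; first by exists 0.
  have [u uP] := cbf_ineq_feasible f alpha alpha' A_spd (g_full p v) pp0.
  by exists u; rewrite h_def.
have h1 : h p0 = 1.
  by rewrite h_def ellipsoid_funE subrr qform0l subr0.
split.
(* Off the center any slope works; [1 * x] is written to match the shape of [cbf_data_id_scale]. *)
- have [u uP] := feas id (fun x => 1 * x).
  exists +oo%E, +oo%E, +oo%E, +oo%E, id, (fun x => 1 * x), setT, setT, u.
  by split=> [|p v _ _]; [exact: cbf_data_id_scale|exact: uP].
- move=> b c b' c' alpha alpha' V _ dalpha _ hp0 _ Vunb H; apply: Vunb.
  have dalpha1 : derivable alpha 1 1 by apply: dalpha; rewrite -h1.
  (* Feasibility on all of [V] would place [V] inside this bounded sublevel set. *)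
  have /bounded_setP[M levelM] :=
    qform_sublevel_bounded (alpha' (alpha 1) / 2) A_spd.
  apply/bounded_setP; exists M => v Vv; apply: levelM => /=.
  have [u] := H v Vv.
  by rewrite h_def cbf_ineq_center// => ?; rewrite ler_pdivlMr// mulrC.
- move=> V /(qform_bounded_above A)[M VM].
  (* At the center [alpha' (alpha 1)] equals [k], which must dominate [2 * M]; the summand [1] keeps
     the slope positive. *)
  pose k := 1 + 2 * `|M|.
  have k0 : 0 < k by rewrite /k ltr_wpDr// mulr_ge0.
  have [u uP] := feas id (fun x => k * x).
  exists +oo%E, +oo%E, +oo%E, +oo%E, id, (fun x => k * x), setT, setT, u.
  split=> [|p v _ _|v Vv]; [exact: cbf_data_id_scale|exact: uP|].
  rewrite h_def; apply/cbf_ineq_center => //.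
  have := VM v Vv; have := ler_norm M; rewrite /k mulr1; lra.
Qed.
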